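(* Let $S$ be a reduced $E$-Fountain semigroup which satisfies the congruence condition and such that the relation $\trianglelefteq_l$ on $S$ is principally finite. Let $\Bbbk$ be a commutative unital ring, let $\mathcal{C}$ be the category associated with $S$, and let $\varphi:\Bbbk S\to\Bbbk\mathcal{C}$ be the $\Bbbk$-module homomorphism defined on basis elements $a\in S$ by $$\varphi(a)=\sum_{c\trianglelefteq_l a}C(c).$$ If $\trianglelefteq_l$ is contained in some principally finite partial order on $S$, then $\varphi$ is an isomorphism of $\Bbbk$-algebras if and only if the generalized right ample condition holds in $S$.
   Context: Let $S$ be a semigroup and $E\subseteq S$ a subset of idempotents, with the natural partial order $e\le f\iff ef=fe=e$. For $a\in S$ put $a_E=\{e\in E\mid ae=a\}$ and ${}_E a=\{e\in E\mid ea=a\}$. Define equivalence relations on $S$ by $a\,\widetilde{\mathcal{L}}_E\,b\iff a_E=b_E$ and $a\,\widetilde{\mathcal{R}}_E\,b\iff {}_Ea={}_Eb$. $S$ is $E$-Fountain if every $\widetilde{\mathcal{L}}_E$-class and every $\widetilde{\mathcal{R}}_E$-class contains an element of $E$; it is reduced if moreover $ef=e\iff fe=e$ for all $e,f\in E$. In a reduced $E$-Fountain semigroup, for every $a\in S$ the sets $a_E$ and ${}_Ea$ have minimum elements with respect to $\le$, denoted $a^\ast$ and $a^+$ respectively. Congruence condition: $\widetilde{\mathcal{L}}_E$ is a right congruence and $\widetilde{\mathcal{R}}_E$ is a left congruence (equivalently, $(ab)^\ast=(a^\ast b)^\ast$ and $(ab)^+=(ab^+)^+$ for all $a,b\in S$).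 Relation $\trianglelefteq_l$: $a\trianglelefteq_l b\iff a=be$ for some $e\in E$. A relation $R$ on a set $X$ is principally finite if $\{x'\in X\mid x'Rx\}$ is finite for every $x\in X$. Associated category $\mathcal{C}$ (when $S$ satisfies the congruence condition): objects are the elements of $E$; morphisms are $C(a)$, in bijection with $a\in S$, where $C(a)$ has domain $a^\ast$ and range $a^+$; composition is from right to left: if $b^\ast=a^+$ then $C(b)\cdot C(a)=C(ba)$. $\Bbbk S$ is the semigroup algebra. The category algebra $\Bbbk\mathcal{C}$ is the free $\Bbbk$-module on the morphisms of $\mathcal{C}$, with multiplication the linear extension of $m'\cdot m=m'm$ if the composition is defined and $0$ otherwise. Generalized right ample condition: $\left(e\left(a(eaf)^\ast\right)^+\right)^\ast=\left(a(eaf)^\ast\right)^+$ for every $a\in S$ and $e,f\in E$. *)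

(* Defs.v *)
From HB Require Import structures.
From mathcomp Require Import all_boot all_order all_algebra.
From mathcomp Require Import finmap monalg.
From mathcomp Require Import mathcomp_extra boolp classical_sets functions.
From mathcomp Require Import cardinality fsbigop.

Set Implicit Arguments.
Unset Strict Implicit.
Unset Printing Implicit Defensive.

Import GRing.Theory.

Local Open Scope classical_set_scope.
Local Open Scope group_scope.

Definition principally_finite (X : Type) (R : X -> X -> Prop) : Prop :=
  forall x, finite_set [set x' | R x' x].

Definition partial_order (X : Type) (R : X -> X -> Prop) : Prop :=
  [/\ forall x, R x x,
      forall x y, R x y -> R y x -> x = y
    & forall x y z, R x y -> R y z -> R x z].

Section Fountain.
Variables (S : semigroupType) (E : set S).

Definition natural_le (e f : S) : Prop := e * f = e /\ f * e = e.

Definition right_ids (a : S) : set S := [set e | E e /\ a * e = a].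
Definition left_ids (a : S) : set S := [set e | E e /\ e * a = a].

Definition Ltilde (a b : S) : Prop := right_ids a = right_ids b.
Definition Rtilde (a b : S) : Prop := left_ids a = left_ids b.

Definition Fountain : Prop :=
  [/\ forall e, E e -> e * e = e,
      forall a, exists2 e, E e & Ltilde e a
    & forall a, exists2 e, E e & Rtilde e a].

Definition reduced_Fountain : Prop :=
  Fountain /\ forall e f, E e -> E f -> (e * f = e <-> f * e = e).

Definition congruence_condition : Prop :=
  (forall a b c, Ltilde a b -> Ltilde (a * c) (b * c)) /\
  (forall a b c, Rtilde a b -> Rtilde (c * a) (c * b)).

Definition is_minimum (A : set S) (m : S) : Prop :=
  A m /\ forall x, A x -> natural_le m x.

(* [xget] falls back on [a] when there is no minimum; [star_min] and
   [plus_min] show that this never happens when [reduced_Fountain] holds. *)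
Definition star (a : S) : S := xget a (is_minimum (right_ids a)).
Definition plus (a : S) : S := xget a (is_minimum (left_ids a)).

Definition tr_l (a b : S) : Prop := exists2 e, E e & a = b * e.

Definition generalized_right_ample : Prop :=
  forall a e f, E e -> E f ->
    star (e * plus (a * star (e * a * f))) = plus (a * star (e * a * f)).

Lemma is_minimum_unique (A : set S) (m n : S) :
  is_minimum A m -> is_minimum A n -> m = n.
Proof. by move=> [Am hm] [An /(_ _ Am)[_ <-]]; case: (hm _ An). Qed.

Section Reduced.
Hypothesis redS : reduced_Fountain.

Lemma star_ex (e a : S) :
  E e -> Ltilde e a -> is_minimum (right_ids a) e.
Proof.
case: redS => -[idE _ _] red Ee <-; split; first by split=> //; exact: idE.
by move=> f [Ef ef]; split=> //; apply/red.
Qed.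

Lemma plus_ex (e a : S) :
  E e -> Rtilde e a -> is_minimum (left_ids a) e.
Proof.
case: redS => -[idE _ _] red Ee <-; split; first by split=> //; exact: idE.
by move=> f [Ef ef]; split=> //; apply/red.
Qed.

Lemma star_min (a : S) : is_minimum (right_ids a) (star a).
Proof.
case: redS => -[_ /(_ a)[e Ee ea] _] _.
by apply: (@xgetPex _ a (is_minimum (right_ids a))); exists e; exact: star_ex.
Qed.

Lemma plus_min (a : S) : is_minimum (left_ids a) (plus a).
Proof.
case: redS => -[_ _ /(_ a)[e Ee ea]] _.
by apply: (@xgetPex _ a (is_minimum (left_ids a))); exists e; exact: plus_ex.
Qed.

Lemma starE (e a : S) : E e -> Ltilde e a -> star a = e.
Proof.
by move=> Ee ea; apply: is_minimum_unique (star_min a) (star_ex Ee ea).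
Qed.

Lemma plusE (e a : S) : E e -> Rtilde e a -> plus a = e.
Proof.
by move=> Ee ea; apply: is_minimum_unique (plus_min a) (plus_ex Ee ea).
Qed.

Lemma star_in (a : S) : E (star a). Proof. by case: (star_min a) => -[]. Qed.
Lemma plus_in (a : S) : E (plus a). Proof. by case: (plus_min a) => -[]. Qed.

Lemma mul_star (a : S) : a * star a = a.
Proof. by case: (star_min a) => -[]. Qed.

Lemma plus_mul (a : S) : plus a * a = a.
Proof. by case: (plus_min a) => -[]. Qed.

Lemma star_Ltilde (a : S) : Ltilde (star a) a.
Proof. by case: redS => -[_ /(_ a)[e Ee ea] _] _; rewrite (starE Ee ea). Qed.

Lemma plus_Rtilde (a : S) : Rtilde (plus a) a.
Proof. by case: redS => -[_ _ /(_ a)[e Ee ea]] _; rewrite (plusE Ee ea). Qed.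

Lemma star_id (e : S) : E e -> star e = e.
Proof. by move=> Ee; apply: starE. Qed.

Lemma plus_id (e : S) : E e -> plus e = e.
Proof. by move=> Ee; apply: plusE. Qed.

Hypothesis congS : congruence_condition.

Lemma star_mul_comp (b a : S) : star b = plus a -> star (b * a) = star a.
Proof.
move=> ba; apply: starE (star_in a) _; rewrite /Ltilde (star_Ltilde a).
have /(_ a) := congS.1 _ _ _ (star_Ltilde b).
by rewrite ba plus_mul.
Qed.

Lemma plus_mul_comp (b a : S) : star b = plus a -> plus (b * a) = plus b.
Proof.
move=> ba; apply: plusE (plus_in b) _; rewrite /Rtilde (plus_Rtilde b).
have /(_ b) := congS.2 _ _ _ (plus_Rtilde a).
by rewrite -ba mul_star.
Qed.

End Reduced.
End Fountain.

(* [comp g f] is the right-to-left composite "g after f", and is [None] when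
   the two morphisms are not composable. *)
Record category := Category {
  obj : Type;
  mor : choiceType;
  dom : mor -> obj;
  cod : mor -> obj;
  idm : obj -> mor;
  comp : mor -> mor -> option mor;
  comp_defined : forall g f, comp g f <-> dom g = cod f;
  comp_dom : forall g f h, comp g f = Some h -> dom h = dom f;
  comp_cod : forall g f h, comp g f = Some h -> cod h = cod g;
  idm_dom : forall x, dom (idm x) = x;
  idm_cod : forall x, cod (idm x) = x;
  comp_idr : forall f, comp f (idm (dom f)) = Some f;
  comp_idl : forall f, comp (idm (cod f)) f = Some f;
  comp_assoc : forall h g f,
    obind (fun hg => comp hg f) (comp h g) = obind (comp h) (comp g f)
}.

Record assoc_mor (S : Type) := C { unC : S }.

HB.instance Definition _ (S : Type) := [isNew for @unC S].
HB.instance Definition _ (S : choiceType) := [Choice of assoc_mor S by <:].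

Section AssociatedCategory.
Variables (S : semigroupType) (E : set S).
Hypotheses (redS : reduced_Fountain E) (congS : congruence_condition E).

Definition ac_obj : Type := {e : S | E e}.

Definition ac_dom (m : assoc_mor S) : ac_obj :=
  exist _ (star E (unC m)) (star_in redS (unC m)).

Definition ac_cod (m : assoc_mor S) : ac_obj :=
  exist _ (plus E (unC m)) (plus_in redS (unC m)).

Definition ac_id (e : ac_obj) : assoc_mor S := C (sval e).

Definition ac_comp (n m : assoc_mor S) : option (assoc_mor S) :=
  if star E (unC n) == plus E (unC m) then Some (C (unC n * unC m)) else None.

Lemma ac_obj_inj (x y : ac_obj) : sval x = sval y -> x = y.
Proof. by case: x y => [x Ex] [y Ey] /= xy; exact: eq_exist. Qed.

Lemma ac_comp_some (n m h : assoc_mor S) : ac_comp n m = Some h ->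
  star E (unC n) = plus E (unC m) /\ h = C (unC n * unC m).
Proof. by rewrite /ac_comp; case: eqP => // -> [<-]. Qed.

Lemma ac_comp_defined (n m : assoc_mor S) :
  ac_comp n m <-> ac_dom n = ac_cod m.
Proof.
rewrite /ac_comp; case: eqP => h; split=> //.
  by move=> _; exact: ac_obj_inj.
by case.
Qed.

Lemma ac_comp_dom (n m h : assoc_mor S) :
  ac_comp n m = Some h -> ac_dom h = ac_dom m.
Proof.
by move=> /ac_comp_some[nm ->]; apply: ac_obj_inj; exact: star_mul_comp.
Qed.

Lemma ac_comp_cod (n m h : assoc_mor S) :
  ac_comp n m = Some h -> ac_cod h = ac_cod n.
Proof.
by move=> /ac_comp_some[nm ->]; apply: ac_obj_inj; exact: plus_mul_comp.
Qed.

Lemma ac_id_dom (x : ac_obj) : ac_dom (ac_id x) = x.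
Proof. by apply: ac_obj_inj; apply: star_id => //; exact: svalP. Qed.

Lemma ac_id_cod (x : ac_obj) : ac_cod (ac_id x) = x.
Proof. by apply: ac_obj_inj; apply: plus_id => //; exact: svalP. Qed.

Lemma ac_comp_idr (m : assoc_mor S) : ac_comp m (ac_id (ac_dom m)) = Some m.
Proof.
case: m => a; rewrite /ac_comp /= (plus_id redS (star_in redS a)) eqxx.
by rewrite mul_star.
Qed.

Lemma ac_comp_idl (m : assoc_mor S) : ac_comp (ac_id (ac_cod m)) m = Some m.
Proof.
case: m => a; rewrite /ac_comp /= (star_id redS (plus_in redS a)) eqxx.
by rewrite plus_mul.
Qed.

Lemma ac_comp_assoc (h g f : assoc_mor S) :
  obind (fun hg => ac_comp hg f) (ac_comp h g) =
  obind (ac_comp h) (ac_comp g f).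
Proof.
rewrite /ac_comp; case: (eqVneq (star E (unC h))) => hg;
  case: (eqVneq (star E (unC g))) => gf //=.
- rewrite (star_mul_comp redS congS hg) (plus_mul_comp redS congS gf) gf hg.
  by rewrite !eqxx mulgA.
- by rewrite (star_mul_comp redS congS hg) (negbTE gf).
- by rewrite (plus_mul_comp redS congS gf) (negbTE hg).
Qed.

Definition associated_category : category :=
  Category ac_comp_defined ac_comp_dom ac_comp_cod ac_id_dom ac_id_cod
    ac_comp_idr ac_comp_idl ac_comp_assoc.

End AssociatedCategory.

Local Open Scope ring_scope.

Section Algebras.
Variable k : comNzRingType.

(* The free [k]-module on [X] is [{malg k[X]}], with basis the [<< x >>]. *)

Definition linear_extension (X : choiceType) (V : lmodType k) (h : X -> V)
    (u : {malg k[X]}) : V :=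
  \sum_(x <- msupp u) u@_x *: h x.

Definition bilinear_extension (X : choiceType) (V : lmodType k)
    (h : X -> X -> V) (u v : {malg k[X]}) : V :=
  \sum_(x <- msupp u) \sum_(y <- msupp v) (u@_x * v@_y) *: h x y.

Definition semigroup_alg_mul (S : semigroupType) :
    {malg k[S]} -> {malg k[S]} -> {malg k[S]} :=
  bilinear_extension (fun a b : S => << (a * b)%g >>).

Definition category_alg_mul (D : category) :
    {malg k[mor D]} -> {malg k[mor D]} -> {malg k[mor D]} :=
  bilinear_extension
    (fun g f : mor D => if comp g f is Some h then << h >> else 0).

(* Algebras are not required to be unital: [S] need not be a monoid, and the
   associated category may have infinitely many objects. When a unit exists,
   a multiplicative bijection automatically preserves it. *)
Definition algebra_isomorphism (A B : lmodType k)
    (mulA : A -> A -> A) (mulB : B -> B -> B) (f : A -> B) : Prop :=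
  [/\ linear f, {morph f : x y / mulA x y >-> mulB x y} & bijective f].

(* The inner sum is over a set that is finite as soon as [tr_l E] is
   principally finite. *)
Definition phi (S : semigroupType) (E : set S) (redS : reduced_Fountain E)
    (congS : congruence_condition E) :
    {malg k[S]} -> {malg k[mor (associated_category redS congS)]} :=
  linear_extension (fun a : S =>
    \sum_(c \in [set c | tr_l E c a])
      (<< C c >> : {malg k[mor (associated_category redS congS)]})).

End Algebras.

Arguments semigroup_alg_mul : clear implicits.
Arguments category_alg_mul : clear implicits.
Arguments phi k {S E} redS congS.

(* Main.v *)
Require Import Defs.
From HB Require Import structures.
From mathcomp Require Import all_boot all_algebra finmap monalg.
From mathcomp Require Import boolp classical_sets cardinality fsbigop.

(** Write [x <| a] for [tr_l E x a]; the witness idempotent can always be taken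
to be [star x], so [x <| a] means [x = a * star x].

[phi] is always bijective. Since [tr_l E] sits inside a principally finite
partial order, counting the elements below in that order gives
every [a] a finite rank that drops strictly along [c <| a], [c <> a]
([principally_finite_rank]). Hence [phi] is unitriangular, and the recursion
[mu a = << a >> - \sum_(c <| a, c <> a) mu c], which is Moebius inversion,
defines its inverse ([zeta_bij]).

For multiplicativity, take [a] and [b] in [S] and expand
[phi << a >> * phi << b >>] in the category algebra. It is a sum over the pairs
[c <| a], [d <| b] for which [C c] and [C d] compose. If they do, then
[star c = plus d], so [c = a * star c = a * plus d] is determined by [d], and
[c * d = a * d]. Conversely [d] occurs in such a pair exactly when
[star (a * plus d) = plus d]; in that case [star (a * d) = star d], so that
[d = b * star (a * d)] is recovered from [x = a * d], and [x <| a * b]. The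
product is therefore the sum of the [C x] over those [x <| a * b] for which
[d = b * star x] satisfies [star (a * plus d) = plus d]
([category_alg_mul_phi], [product_supportP]), whereas [phi << a * b >>] is the
sum over all [x <| a * b]. Basis elements being independent over the nontrivial
ring [k], the two agree if and only if the extra condition is automatic.

With [x = a * b * f], that condition reads
[star (a * plus (b * star (a * b * f))) = plus (b * star (a * b * f))]. By the
congruence condition it depends on [a] only through [star a], so it is enough
to require it for [a] in [E], where it is the generalized right ample condition
([generalized_right_ampleE]). *)

Set Implicit Arguments.
Unset Strict Implicit.
Unset Printing Implicit Defensive.

Import GRing.Theory.

Local Open Scope classical_set_scope.
Local Open Scope ring_scope.

(** * Linear and bilinear extension from a basis *)

Section FreeModule.
Context {k : comNzRingType} {X : choiceType}.
Implicit Types (V : lmodType k) (u v : {malg k[X]}).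

Lemma malg_basis u : u = \sum_(x <- msupp u) u@_x *: << x >>.
Proof.
rewrite {1}[u]monalgE; apply: eq_bigr => x _; apply/malgP => y.
by rewrite mcoeffZ !mcoeffU mulr_natr.
Qed.

(** Takes [linear] as a property rather than a bundled map, so that it applies
directly to partial applications of a product and to composites with it. *)
Lemma eq_linear_basis V (f g : {malg k[X]} -> V) : linear f -> linear g ->
  (forall x, f << x >> = g << x >>) -> f =1 g.
Proof.
move=> lf lg fg u.
pose f' : {linear _ -> V} := HB.pack f (GRing.isLinear.Build _ _ _ _ f lf).
pose g' : {linear _ -> V} := HB.pack g (GRing.isLinear.Build _ _ _ _ g lg).
change (f' u = g' u); rewrite [u]malg_basis !linear_sum.
by apply: eq_bigr => x _; rewrite !linearZ /= fg.
Qed.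

(** Sums of two vectors have a different support from each of them; linearity is
checked by first moving all sums to one common index set. *)
Lemma linear_extension_widen V (h : X -> V) u (d : {fset X}) :
  (msupp u `<=` d)%fset -> linear_extension h u = \sum_(x <- d) u@_x *: h x.
Proof.
move=> ud; rewrite /linear_extension (big_fset_incl _ ud) // => x _.
by move=> /mcoeff_outdom ->; rewrite scale0r.
Qed.

Lemma linear_extension_linear V (h : X -> V) : linear (linear_extension h).
Proof.
move=> c u v; pose d := (msupp (c *: u + v) `|` (msupp u `|` msupp v))%fset.
have [wd ud vd] : [/\ msupp (c *: u + v) `<=` d, msupp u `<=` d
                     & msupp v `<=` d]%fset.
  by split; apply/fsubsetP => x xd; rewrite !in_fsetU xd ?orbT.
rewrite !(@linear_extension_widen _ _ _ d) //.
rewrite scaler_sumr -big_split; apply: eq_bigr => x _ /=.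
by rewrite mcoeffD mcoeffZ scalerDl scalerA.
Qed.

Lemma linear_extensionU V (h : X -> V) x : linear_extension h << x >> = h x.
Proof.
rewrite (linear_extension_widen _ (@msuppU_le _ _ x 1)) big_seq_fset1.
by rewrite mcoeffUU scale1r.
Qed.

HB.instance Definition _ V (h : X -> V) :=
  GRing.isLinear.Build k {malg k[X]} V *:%R (linear_extension h)
    (linear_extension_linear h).

Lemma bilinear_extensionl V (h : X -> X -> V) u v :
  bilinear_extension h u v =
  linear_extension (fun x => linear_extension (h x) v) u.
Proof.
apply: eq_bigr => x _; rewrite scaler_sumr.
by apply: eq_bigr => y _; rewrite scalerA.
Qed.

Lemma bilinear_extensionr V (h : X -> X -> V) u v :
  bilinear_extension h u v =
  linear_extension (fun y => linear_extension (h^~ y) u) v.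
Proof.
rewrite /bilinear_extension exchange_big; apply: eq_bigr => y _.
by rewrite scaler_sumr; apply: eq_bigr => x _; rewrite scalerA mulrC.
Qed.

Lemma bilinear_extension_linearl V (h : X -> X -> V) v :
  linear (bilinear_extension h ^~ v).
Proof. by move=> c u u'; rewrite !bilinear_extensionl linearP. Qed.

Lemma bilinear_extension_linearr V (h : X -> X -> V) u :
  linear (bilinear_extension h u).
Proof. by move=> c v v'; rewrite !bilinear_extensionr linearP. Qed.

Lemma bilinear_extensionU V (h : X -> X -> V) x y :
  bilinear_extension h << x >> << y >> = h x y.
Proof. by rewrite bilinear_extensionl !linear_extensionU. Qed.

Lemma bilinear_extension_sum V (h : X -> X -> V) (r s : seq X) :
  bilinear_extension h (\sum_(x <- r) << x >>) (\sum_(y <- s) << y >>) =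
  \sum_(x <- r) \sum_(y <- s) h x y.
Proof.
rewrite bilinear_extensionl linear_sum; apply: eq_bigr => x _.
rewrite /= linear_extensionU linear_sum; apply: eq_bigr => y _.
exact: linear_extensionU.
Qed.

(** A repetition-free sum of basis elements has a characteristic function as its
coefficients, so that [1 != 0] in [k] lets its index set be read off. *)
Lemma mcoeff_sum_basis (r : seq X) x : uniq r ->
  (\sum_(y <- r) << y >> : {malg k[X]})@_x = (x \in r)%:R.
Proof.
elim: r => [|y r IHr] /=; first by rewrite big_nil mcoeff0.
move=> /andP[yr /IHr {}IHr]; rewrite big_cons mcoeffD IHr mcoeffU inE eq_sym.
by case: eqP => [->|_]; rewrite /= ?add0r // (negbTE yr) addr0.
Qed.

Lemma sum_basis_inj (r s : seq X) : uniq r -> uniq s ->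
  \sum_(y <- r) << y >> = \sum_(y <- s) << y >> :> {malg k[X]} <-> r =i s.
Proof.
move=> ur us; split=> [rs x | rs].
  have := congr1 (mcoeff x) rs; rewrite !mcoeff_sum_basis // => /eqP.
  by case: (x \in r) (x \in s) => -[]//; rewrite ?(eq_sym 0) oner_eq0.
by apply: perm_big; apply: uniq_perm.
Qed.

End FreeModule.

(** Both sides are linear in [u] and in [v], so they agree as soon as they agree
on basis elements. *)
Lemma bilinear_extension_morph (k : comNzRingType) (X Y : choiceType)
    (h : X -> X -> {malg k[X]}) (h' : Y -> Y -> {malg k[Y]})
    (f : {malg k[X]} -> {malg k[Y]}) : linear f ->
  (forall x y, f (h x y) = bilinear_extension h' (f << x >>) (f << y >>)) ->
  {morph f : u v / bilinear_extension h u v >-> bilinear_extension h' u v}.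
Proof.
move=> lf fh u v; move: u; apply: eq_linear_basis.
- by move=> c u u'; rewrite bilinear_extension_linearl lf.
- by move=> c u u'; rewrite lf bilinear_extension_linearl.
move=> x; move: v; apply: eq_linear_basis.
- by move=> c v v'; rewrite bilinear_extension_linearr lf.
- by move=> c v v'; rewrite lf bilinear_extension_linearr.
by move=> y; rewrite bilinear_extensionU.
Qed.

(** * Moebius inversion along a ranked relation *)

(** The rank counts the elements below: passing from [x] to a strictly larger
[y] keeps everything below [x] by transitivity and adds [y] itself. *)
Lemma principally_finite_rank (X : choiceType) (le : X -> X -> Prop) :
  partial_order le -> principally_finite le ->
  exists rk : X -> nat, forall x y, le x y -> x <> y -> (rk x < rk y)%N.
Proof.
move=> [lexx anti trans] fin.
exists (fun x => #|` fset_set [set x' | le x' x]|) => x y xy nxy.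
apply: fproper_ltn_card; rewrite fproperE; apply/andP; split.
  apply/fsubsetP => z; rewrite !in_fset_set // !inE => zx.
  exact: trans zx xy.
apply/fsubsetPn; exists y; rewrite in_fset_set ?inE //.
by apply/negP; rewrite inE => yx; apply: nxy; apply: anti.
Qed.

Section Mobius.
Context {k : comNzRingType} {X Y : choiceType}.
Variables (j : X -> Y) (low : X -> seq X) (rk : X -> nat).
Hypothesis low_uniq : forall a, uniq (low a).
Hypothesis low_refl : forall a, a \in low a.
Hypothesis low_rk : forall a c, c \in low a -> c != a -> (rk c < rk a)%N.

Definition zeta : {linear {malg k[X]} -> {malg k[Y]}} :=
  linear_extension (fun a => \sum_(c <- low a) (<< j c >> : {malg k[Y]})).

Lemma zetaU a : zeta << a >> = \sum_(c <- low a) << j c >>.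
Proof. exact: linear_extensionU. Qed.

(** The inverse is defined by recursion along the strict part of the relation;
[n] is fuel, and [mobius_rec_stable] shows that any amount above the rank gives
the same value. *)
Fixpoint mobius_rec (n : nat) (a : X) : {malg k[X]} :=
  if n is m.+1 then << a >> - \sum_(c <- low a | c != a) mobius_rec m c else 0.

Definition mobius a := mobius_rec (rk a).+1 a.

Lemma mobius_rec_stable n m a :
  (rk a < n)%N -> (rk a < m)%N -> mobius_rec n a = mobius_rec m a.
Proof.
elim: n m a => [|n IHn] [|m] a //= an am; congr (_ - _).
rewrite [LHS]big_seq_cond [RHS]big_seq_cond; apply: eq_bigr => c /andP[ca nca].
by apply: IHn; apply: leq_trans (low_rk ca nca) _.
Qed.

Lemma mobiusE a : mobius a = << a >> - \sum_(c <- low a | c != a) mobius c.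
Proof.
rewrite {1}/mobius /=; congr (_ - _).
rewrite [LHS]big_seq_cond [RHS]big_seq_cond; apply: eq_bigr => c /andP[ca nca].
by apply: mobius_rec_stable (ltnSn _); apply: low_rk.
Qed.

Lemma zeta_mobius a : zeta (mobius a) = << j a >>.
Proof.
have [n] := ubnP (rk a); elim: n a => // n IHn a an.
rewrite mobiusE linearB (linear_sum zeta) zetaU (bigD1_seq a) //=.
suff -> : \sum_(c <- low a | c != a) zeta (mobius c) =
          \sum_(c <- low a | c != a) << j c >> by rewrite addrK.
rewrite [LHS]big_seq_cond [RHS]big_seq_cond; apply: eq_bigr => c /andP[ca nca].
by apply: IHn; apply: leq_trans (low_rk ca nca) _.
Qed.

(** [mobiusE] rearranges to [\sum_(c <- low a) mobius c = << a >>], which is one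
of the two cancellation laws on the basis; [zeta_mobius] is the other. *)
Lemma zeta_bij : bijective j -> bijective zeta.
Proof.
case=> j' jK j'K.
pose mu : {linear {malg k[Y]} -> {malg k[X]}} :=
  linear_extension (fun y => mobius (j' y)).
have muU y : mu << y >> = mobius (j' y) by exact: linear_extensionU.
exists mu.
- apply: eq_linear_basis => // [c u v|x]; first by rewrite !linearP.
  rewrite zetaU linear_sum; under eq_bigr do rewrite muU jK.
  by rewrite (bigD1_seq x) //= mobiusE subrK.
- apply: eq_linear_basis => // [c u v|y]; first by rewrite !linearP.
  by rewrite muU zeta_mobius j'K.
Qed.

End Mobius.

(** * Products in the semigroup and composites in the category *)

Section Products.
Local Open Scope group_scope.
Variables (S : semigroupType) (E : set S).
Hypotheses (redS : reduced_Fountain E) (congS : congruence_condition E).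
Hypothesis finS : principally_finite (tr_l E).
Implicit Types a b c d x : S.

Local Notation star := (star E).
Local Notation plus := (plus E).

Definition restrictions a : seq S := fset_set [set c | tr_l E c a].

Lemma restrictionsP a c : reflect (tr_l E c a) (c \in restrictions a).
Proof. by rewrite in_fset_set //; apply: (iffP idP) => [/set_mem|/mem_set]. Qed.

Lemma restrictions_uniq a : uniq (restrictions a).
Proof. exact: fset_uniq. Qed.

(** If [x = a * e] then [x * e = x], so [star x] lies below [e], and
[a * star x = a * (e * star x) = x * star x = x]. *)
Lemma tr_lE x a : tr_l E x a <-> x = a * star x.
Proof.
split=> [[e Ee xe] | ->]; last first.
  by exists (star x) => //; apply: star_in.
have [[idE _ _] _] := redS; have [_ minx] := star_min redS x.
have [|_ <-] := minx e; first by split=> //; rewrite xe -mulgA idE.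
by rewrite mulgA -xe mul_star.
Qed.

Lemma star_mull a b : star (a * b) = star (star a * b).
Proof.
apply: starE => //; first exact: star_in.
by rewrite /Ltilde star_Ltilde //; apply: congS.1; apply: star_Ltilde.
Qed.

(** The only restriction of [a] that can compose with [d] is [a * plus d], by
[composable_restriction]; the condition here is that it does. *)
Definition composable a d := star (a * plus d) == plus d.

(** Restricting [a] to [a * plus d] does not change its product with [d], and a
composite has the domain of the factor applied first. *)
Lemma composable_star a d : composable a d -> star (a * d) = star d.
Proof.
by move=> /eqP ad; rewrite -{1}[d](plus_mul redS) mulgA star_mull ad plus_mul.
Qed.

Lemma composable_restriction a c d : c \in restrictions a ->
  star c = plus d -> c = a * plus d.
Proof. by move=> /restrictionsP/tr_lE ca <-. Qed.

(** The indices of the basis elements in [phi << a >> * phi << b >>], see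
[category_alg_mul_phi]. *)
Definition product_support a b : seq S :=
  [seq a * d | d <- restrictions b & composable a d].

(** The preimage of [x] under [d |-> a * d] has to be [b * star x], because
[d = b * star d] and [star d = star (a * d)]. *)
Lemma product_supportP a b x :
  reflect (tr_l E x (a * b) /\ composable a (b * star x))
          (x \in product_support a b).
Proof.
apply: (iffP mapP) => [[d + ->] | [/tr_lE xab compx]].
  rewrite mem_filter => /andP[ad /restrictionsP/tr_lE db].
  rewrite (composable_star ad) -db; split=> //.
  by exists (star d); [apply: star_in | rewrite -mulgA -db].
exists (b * star x); last by rewrite mulgA.
rewrite mem_filter compx; apply/restrictionsP.
by exists (star x) => //; apply: star_in.
Qed.

Lemma product_support_uniq a b : uniq (product_support a b).
Proof.
rewrite map_inj_in_uniq ?filter_uniq ?restrictions_uniq // => d d'.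
rewrite !mem_filter => /andP[ad /restrictionsP/tr_lE db].
move=> /andP[ad' /restrictionsP/tr_lE db'] dd'.
by rewrite db db' -(composable_star ad) -(composable_star ad') dd'.
Qed.

(** The ample condition only speaks of left factors in [E]; a general left
factor [a] is replaced by [star a], since [star (a * y) = star (star a * y)].
Conversely, the condition for [e], [a], [f] is the case [x = e * a * f] of
[product_supportP]. *)
Lemma generalized_right_ampleE : generalized_right_ample E <->
  forall a b, restrictions (a * b) =i product_support a b.
Proof.
split=> [ample a b x | full a e f Ee Ef].
  apply/restrictionsP/product_supportP => [xab | []//]; split=> //.
  case: xab => f Ef xE; rewrite /composable star_mull.
  have -> : star x = star (star a * b * f).
    by rewrite xE -mulgA [LHS]star_mull mulgA.
  by apply/eqP; apply: ample => //; apply: star_in.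
have x_eaf : e * a * f \in restrictions (e * a).
  by apply/restrictionsP; exists f.
by move: x_eaf; rewrite full => /product_supportP[_ /eqP].
Qed.

Variable k : comNzRingType.
Local Notation cat := (associated_category redS congS).
Local Notation phi := (phi k redS congS).

Lemma phiU a : phi << a >> =
  \sum_(m <- map (C (S:=S)) (restrictions a)) (<< m >> : {malg k[mor cat]}).
Proof. by rewrite big_map /Defs.phi linear_extensionU fsbig_finite. Qed.

(** For fixed [d], at most one term of the sum over the restrictions [c] of [a]
survives, namely [c = a * plus d], and it contributes
[C (a * plus d * d) = C (a * d)]. *)
Lemma category_alg_mul_phi a b :
  category_alg_mul k cat (phi << a >>) (phi << b >>) =
  \sum_(m <- map (C (S:=S)) (product_support a b))
    (<< m >> : {malg k[mor cat]}).
Proof.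
rewrite !phiU /category_alg_mul bilinear_extension_sum !big_map exchange_big /=.
rewrite [LHS]big_map big_filter [RHS]big_mkcond /=; apply: eq_bigr => d _ /=.
rewrite /ac_comp /=; case: ifP => [ad | nad].
  rewrite (bigD1_seq (a * plus d)) ?restrictions_uniq //=; last first.
    by apply/restrictionsP; exists (plus d) => //; apply: plus_in.
  rewrite (eqP ad) eqxx -mulgA plus_mul // big1_seq ?addr0 // => c /andP[nc ca].
  by case: eqP => // /(composable_restriction ca) cE; rewrite cE eqxx in nc.
rewrite big1_seq // => c /andP[_ ca]; case: eqP => // cd.
by rewrite /composable -(composable_restriction ca cd) cd eqxx in nad.
Qed.

Lemma phiM_basis a b :
  phi << a * b >> = category_alg_mul k cat (phi << a >>) (phi << b >>) <->
  restrictions (a * b) =i product_support a b.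
Proof.
have C_inj : injective (C (S:=S)) by move=> x y [].
rewrite phiU category_alg_mul_phi sum_basis_inj;
  try by rewrite map_inj_uniq ?restrictions_uniq ?product_support_uniq.
split=> [eqC x | eqab]; last exact: eq_mem_map.
by rewrite -(mem_map C_inj) eqC mem_map.
Qed.

Lemma phi_bij (le : S -> S -> Prop) : partial_order le ->
  principally_finite le -> (forall a b, tr_l E a b -> le a b) -> bijective phi.
Proof.
move=> po_le fin_le tr_le.
have [rk rkP] := principally_finite_rank po_le fin_le.
have low_refl a : a \in restrictions a.
  by apply/restrictionsP/tr_lE; rewrite mul_star.
have low_rk a c : c \in restrictions a -> c != a -> (rk c < rk a)%N.
  by move=> /restrictionsP/tr_le ca /eqP; apply: rkP.
have C_bij : bijective (C (S:=S)) by exists (@unC S) => // -[].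
apply: eq_bij (zeta_bij (k:=k) restrictions_uniq low_refl low_rk C_bij) _ _.
apply: eq_linear_basis; try exact: linearP.
by move=> a; rewrite zetaU phiU big_map.
Qed.

End Products.

Theorem theorem4p4 (S : semigroupType) (E : set S)
    (redS : reduced_Fountain E) (congS : congruence_condition E)
    (finS : principally_finite (tr_l E))
    (k : comNzRingType)
    (ordS : exists le : S -> S -> Prop,
      [/\ partial_order le, principally_finite le
        & forall a b : S, tr_l E a b -> le a b]) :
  algebra_isomorphism (semigroup_alg_mul k S)
    (category_alg_mul k (associated_category redS congS)) (phi k redS congS)
  <-> generalized_right_ample E.
Proof.
have [le [po_le fin_le tr_le]] := ordS.
rewrite (generalized_right_ampleE redS congS finS).
split=> [[_ phiM _] a b | full].
  apply/(phiM_basis redS congS finS k).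
  by rewrite -phiM /semigroup_alg_mul bilinear_extensionU.
have phi_lin : linear (phi k redS congS) by apply: linearP.
split; [exact: phi_lin | | exact: phi_bij po_le fin_le tr_le].
apply: (bilinear_extension_morph phi_lin) => a b.
exact/phiM_basis.
Qed.
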